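(* (General solution for five-stage third-order 2N-storage methods.) Let $c_1=0$ and let $c_2,c_3,c_4,c_5,b_5$ be real numbers with $c_2,c_3,c_4,b_5\neq0$, $c_2\ne c_3$, $c_3\neq c_4$, $c_4\neq c_5$ and $1-b_5-c_4\neq0$. Let $b_1,b_2,b_3,b_4$ be real numbers with $b_2,b_3,b_4\neq0$, $b_1+b_2-c_2\neq0$, $b_1+b_2+b_3-c_3\ne0$ and $b_1+b_2+b_3+b_4-c_4\neq0$. Define $$\omega_1=\frac{c_4(1/2-b_5c_5)-(1/3-b_5c_5^2)}{c_3(c_4-c_3)},\quad \rho_1=-\frac{c_2(c_4-c_2)}{c_3(c_4-c_3)},$$ $$\omega_2=\frac{1/3-b_5c_5^2-c_3(1/2-b_5c_5)}{c_4(c_4-c_3)},\quad \rho_2=\frac{c_2(c_3-c_2)}{c_4(c_4-c_3)},$$ $$\omega_3=\frac{(c_5-c_4)\omega_2}{1-b_5-c_4},\quad \rho_3=\frac{(c_5-c_4)\rho_2}{1-b_5-c_4},$$ $$\omega_4=b_5c_4\omega_3-1/6,\quad \rho_4=b_5c_4\rho_3,\qquad \omega_5=b_5c_3(c_5-c_3-\omega_3),\quad \rho_5=-b_5c_3\rho_3,$$ $$\omega_6=1-b_5-c_3-\omega_2,\quad \rho_6=-\rho_2,$$ $$\omega_7=b_5c_2[(c_5-\omega_3)(\omega_6-\omega_1)-c_2\omega_6+c_3\omega_1],\quad \zeta_7=b_5c_2\rho_3(\rho_1-\rho_6),$$ $$\rho_7=b_5c_2[\rho_3(\omega_1-\omega_6)+(c_5-\omega_3)(\rho_6-\rho_1)-c_2\rho_6+c_3\rho_1],$$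 $$\omega_8=c_2[(c_4-c_2)\omega_6-(c_4-c_3)\omega_1],\quad \rho_8=c_2[(c_4-c_2)\rho_6-(c_4-c_3)\rho_1],$$ $$\omega_9=1-b_5-c_2-\omega_1-\omega_2,\quad \rho_9=-\rho_1-\rho_2,$$ and $$\chi_1^0=\omega_4\omega_6\omega_9,\quad \chi_1^1=\omega_4\omega_6\rho_9+\omega_4\rho_6\omega_9+\rho_4\omega_6\omega_9,$$ $$\chi_1^2=\omega_4\rho_6\rho_9+\rho_4\omega_6\rho_9+\rho_4\rho_6\omega_9,\quad \chi_1^3=\rho_4\rho_6\rho_9,$$ $$\chi_2^0=\omega_1\omega_5\omega_9,\quad \chi_2^1=\omega_1\omega_5\rho_9+\omega_1\rho_5\omega_9+\rho_1\omega_5\omega_9,$$ $$\chi_2^2=\omega_1\rho_5\rho_9+\rho_1\omega_5\rho_9+\rho_1\rho_5\omega_9,\quad \chi_2^3=\rho_1\rho_5\rho_9,$$ $$\chi_3^0=0,\quad \chi_3^1=\omega_7,\quad \chi_3^2=\rho_7,\quad \chi_3^3=\zeta_7,$$ $$\chi_4^0=c_3(c_4-c_3)\omega_1\omega_2\omega_9,\quad \chi_4^1=c_3(c_4-c_3)(\omega_1\omega_2\rho_9+\omega_1\rho_2\omega_9+\rho_1\omega_2\omega_9),$$ $$\chi_4^2=c_3(c_4-c_3)(\omega_1\rho_2\rho_9+\rho_1\omega_2\rho_9+\rho_1\rho_2\omega_9),\quad \chi_4^3=c_3(c_4-c_3)\rho_1\rho_2\rho_9,$$ $$\chi_5^0=0,\quad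 \chi_5^1=\omega_2\omega_8,\quad \chi_5^2=\omega_2\rho_8+\rho_2\omega_8,\quad \chi_5^3=\rho_2\rho_8,$$ $$\chi_6^0=0,\quad \chi_6^1=c_2(c_3-c_2)\omega_1\omega_6,\quad \chi_6^2=c_2(c_3-c_2)(\omega_1\rho_6+\rho_1\omega_6),\quad \chi_6^3=c_2(c_3-c_2)\rho_1\rho_6,$$ and $\mathcal C_k=\sum_{n=1}^6\chi_n^k$ for $k=0,1,2,3$ (superscripts on $\chi$ are indices, not powers). Then $\mathcal C_3=0$, and $c_i$, $b_i$ ($i=1,\dots,5$) are the nodes and weights of a five-stage explicit 2N-storage Runge-Kutta method satisfying the third-order conditions $$\sum_i b_i=1,\quad \sum_i b_ic_i=\tfrac12,\quad \sum_i b_ic_i^2=\tfrac13,\quad \sum_{i,j}b_ia_{ij}c_j=\tfrac16$$ if and only if $$\mathcal C_2b_2^2+\mathcal C_1b_2+\mathcal C_0=0,\quad b_3=\omega_1+\rho_1b_2,\quad b_4=\omega_2+\rho_2b_2,\quad b_1=1-b_2-b_3-b_4-b_5.$$ In that case the remaining coefficients of the method are given, for $2\le j<i\le5$, recursively (for each $i$, with $j$ decreasing from $i-1$) by $$a_{ij}=\frac{b_j}{\sum_{k=1}^{j}b_k-c_j}\Big[c_i-c_j-\sum_{k=j+1}^{i-1}a_{ik}\Big],$$ and by $a_{i1}=c_i-\sum_{k=2}^{i-1}a_{ik}$ for $i=2,\dots,5$.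
   Context: Empty sums equal $0$. An $s$-stage explicit Runge-Kutta method ($a$-form) has real coefficients $a_{ij}$ ($i,j=1,\dots,s$, $a_{ij}=0$ for $i\le j$), weights $b_i$ and nodes $c_i=\sum_{j=1}^{i-1}a_{ij}$ (so $c_1=0$). With step size $h$ it computes $y_i=y_0+h\sum_{j=1}^{i-1}a_{ij}k_j$, $k_i=f(t+c_ih,y_i)$, $i=1,\dots,s$, and $y_{s+1}=y_0+h\sum_{i=1}^s b_ik_i$. 2N-storage method ($A$-form): the method is a 2N-storage method if there are coefficients $A_1=0,A_2,\dots,A_s$ and $B_1,\dots,B_s$, all $B_i\ne0$, such that its stages coincide (identically, as formal linear combinations of $y_0$ and $k_1,\dots,k_s$, treated as independent symbols) with those produced by $y_1=y_0$, $\Delta y_2=hk_1$, $\Delta y_i=A_{i-1}\Delta y_{i-1}+hk_{i-1}$ for $i=3,\dots,s+1$, and $y_i=y_{i-1}+B_{i-1}\Delta y_i$ for $i=2,\dots,s+1$. *)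

(* Defs.v *)
From mathcomp Require Export all_boot all_order all_algebra.
From mathcomp Require Export reals.

Set Implicit Arguments.
Unset Strict Implicit.
Unset Printing Implicit Defensive.

Import Order.TTheory GRing.Theory Num.Theory.

Local Open Scope ring_scope.

(* Stages, nodes and weights are indexed from 1, as in the usual notation for
   Runge-Kutta methods: a tableau is given by a : nat -> nat -> R and
   b : nat -> R, of which only the values at indices 1..s are meaningful. *)

Definition explicit_tableau (R : realType) (s : nat) (a : nat -> nat -> R) : Prop :=
  forall i j, (1 <= i <= s)%N -> (1 <= j <= s)%N -> (i <= j)%N -> a i j = 0.

Definition rk_node (R : realType) (a : nat -> nat -> R) (i : nat) : R :=
  \sum_(1 <= j < i) a i j.

(* y_i for 1 <= i <= s, and the new value y_{s+1} for i = s+1, as a combination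
   of y_0 and the stage derivatives k_1, ..., k_s. *)
Definition rk_stage (R : realType) (V : lmodType R) (s : nat)
    (a : nat -> nat -> R) (b : nat -> R) (h : R) (y0 : V) (k : nat -> V)
    (i : nat) : V :=
  if i == s.+1 then y0 + h *: \sum_(1 <= j < s.+1) b j *: k j
  else y0 + h *: \sum_(1 <= j < i) a i j *: k j.

(* The increments of the 2N-storage scheme. We put delta_2N 1 = 0, so that
   delta_2N 2 = A 1 *: 0 + h *: k 1 = h *: k 1. *)
Fixpoint delta_2N (R : realType) (V : lmodType R) (A : nat -> R) (h : R)
    (k : nat -> V) (i : nat) : V :=
  match i with
  | (_.+1 as i').+1 => A i' *: delta_2N A h k i' + h *: k i'
  | _ => 0
  end.

Fixpoint stage_2N (R : realType) (V : lmodType R) (A B : nat -> R) (h : R)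
    (y0 : V) (k : nat -> V) (i : nat) : V :=
  match i with
  | (_.+1 as i').+1 => stage_2N A B h y0 k i' + B i' *: delta_2N A h k i
  | _ => y0
  end.

(* The independent symbols y_0, k_1, ..., k_s are the canonical basis vectors
   0, 1, ..., s of R^(s+1). *)
Definition formal_symbol (R : realType) (s : nat) (j : nat) : 'rV[R]_s.+1 :=
  delta_mx ord0 (inord j).

Definition storage_2N (R : realType) (s : nat)
    (a : nat -> nat -> R) (b : nat -> R) : Prop :=
  exists A B : nat -> R,
    [/\ A 1%N = 0,
        forall i, (1 <= i <= s)%N -> B i != 0
      & forall (h : R) (i : nat), (1 <= i <= s.+1)%N ->
          rk_stage s a b h (formal_symbol R s 0) (formal_symbol R s) i
          = stage_2N A B h (formal_symbol R s 0) (formal_symbol R s) i].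

Definition third_order (R : realType) (s : nat)
    (a : nat -> nat -> R) (b : nat -> R) : Prop :=
  [/\ \sum_(1 <= i < s.+1) b i = 1,
      \sum_(1 <= i < s.+1) b i * rk_node a i = 1 / 2,
      \sum_(1 <= i < s.+1) b i * rk_node a i ^+ 2 = 1 / 3
    & \sum_(1 <= i < s.+1) \sum_(1 <= j < s.+1) b i * a i j * rk_node a j
      = 1 / 6].

Definition third_order_2N_method (R : realType) (s : nat)
    (c b : nat -> R) (a : nat -> nat -> R) : Prop :=
  [/\ explicit_tableau s a,
      forall i, (1 <= i <= s)%N -> rk_node a i = c i,
      storage_2N s a b
    & third_order s a b].

Section Coefficients.
Context (R : realType) (c2 c3 c4 c5 b5 : R).

Definition omega1 : R :=
  (c4 * (1 / 2 - b5 * c5) - (1 / 3 - b5 * c5 ^+ 2)) / (c3 * (c4 - c3)).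
Definition rho1 : R := - ((c2 * (c4 - c2)) / (c3 * (c4 - c3))).

Definition omega2 : R :=
  (1 / 3 - b5 * c5 ^+ 2 - c3 * (1 / 2 - b5 * c5)) / (c4 * (c4 - c3)).
Definition rho2 : R := (c2 * (c3 - c2)) / (c4 * (c4 - c3)).

Definition omega3 : R := ((c5 - c4) * omega2) / (1 - b5 - c4).
Definition rho3 : R := ((c5 - c4) * rho2) / (1 - b5 - c4).

Definition omega4 : R := b5 * c4 * omega3 - 1 / 6.
Definition rho4 : R := b5 * c4 * rho3.

Definition omega5 : R := b5 * c3 * (c5 - c3 - omega3).
Definition rho5 : R := - (b5 * c3 * rho3).

Definition omega6 : R := 1 - b5 - c3 - omega2.
Definition rho6 : R := - rho2.

Definition omega7 : R :=
  b5 * c2 * ((c5 - omega3) * (omega6 - omega1) - c2 * omega6 + c3 * omega1).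
Definition zeta7 : R := b5 * c2 * rho3 * (rho1 - rho6).
Definition rho7 : R :=
  b5 * c2 * (rho3 * (omega1 - omega6) + (c5 - omega3) * (rho6 - rho1)
             - c2 * rho6 + c3 * rho1).

Definition omega8 : R := c2 * ((c4 - c2) * omega6 - (c4 - c3) * omega1).
Definition rho8 : R := c2 * ((c4 - c2) * rho6 - (c4 - c3) * rho1).

Definition omega9 : R := 1 - b5 - c2 - omega1 - omega2.
Definition rho9 : R := - rho1 - rho2.

(* (chi n)`_k is the coefficient written chi_n^k, where k is an upper index,
   0 <= k <= 3. *)
Definition chi (n : nat) : seq R :=
  match n with
  | 1 => [:: omega4 * omega6 * omega9;
             omega4 * omega6 * rho9 + omega4 * rho6 * omega9
               + rho4 * omega6 * omega9;
             omega4 * rho6 * rho9 + rho4 * omega6 * rho9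
               + rho4 * rho6 * omega9;
             rho4 * rho6 * rho9]
  | 2 => [:: omega1 * omega5 * omega9;
             omega1 * omega5 * rho9 + omega1 * rho5 * omega9
               + rho1 * omega5 * omega9;
             omega1 * rho5 * rho9 + rho1 * omega5 * rho9
               + rho1 * rho5 * omega9;
             rho1 * rho5 * rho9]
  | 3 => [:: 0; omega7; rho7; zeta7]
  | 4 => [:: c3 * (c4 - c3) * omega1 * omega2 * omega9;
             c3 * (c4 - c3) * (omega1 * omega2 * rho9 + omega1 * rho2 * omega9
                               + rho1 * omega2 * omega9);
             c3 * (c4 - c3) * (omega1 * rho2 * rho9 + rho1 * omega2 * rho9
                               + rho1 * rho2 * omega9);
             c3 * (c4 - c3) * rho1 * rho2 * rho9]
  | 5 => [:: 0;
             omega2 * omega8;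
             omega2 * rho8 + rho2 * omega8;
             rho2 * rho8]
  | 6 => [:: 0;
             c2 * (c3 - c2) * omega1 * omega6;
             c2 * (c3 - c2) * (omega1 * rho6 + rho1 * omega6);
             c2 * (c3 - c2) * rho1 * rho6]
  | _ => [::]
  end.

Definition coefC (k : nat) : R := \sum_(1 <= n < 7) (chi n)`_k.

End Coefficients.

(* Main.v *)
(* Identifying coefficients, a 2N-storage method satisfies
   a_ij = B_j + A_{j+1} a_{i,j+1}, with the weights b as row s + 1. Hence
   sum_{k <= j} a_ik - c_j is proportional to a_ij with a factor that does not
   depend on the row i, which gives the recursion for a_ij; conversely, the
   recursion determines A and B. The first three order conditions are linear in
   b1, b3, b4 and express them through b2. The fourth one, multiplied by the
   nonzero denominators of the recursion, is the polynomial equation for b2. *)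

Require Import Defs.
From mathcomp Require Import ring lra zify.

Set Implicit Arguments.
Unset Strict Implicit.
Unset Printing Implicit Defensive.

Import Order.TTheory GRing.Theory Num.Theory.

Local Open Scope ring_scope.

(** * Coefficients of the 2N-storage scheme *)

(** This is the coefficient of [h *: k j] in stage [i]: the update at step [m] brings in [k j] with
    weight [B m], after damping by [A j.+1], ..., [A m]. *)
Definition coef_2N (R : realType) (A B : nat -> R) (i j : nat) : R :=
  \sum_(j <= m < i) B m * \prod_(j.+1 <= l < m.+1) A l.

Lemma coef_2N_geq (R : realType) (A B : nat -> R) i j :
  (i <= j)%N -> coef_2N A B i j = 0.
Proof. exact: big_geq. Qed.

(** Every term added between stages [j] and [i] carries the factors [A k.+1], ..., [A j], since
    [k k] then acts only through the increment. The common factor does not involve [i]. *)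
Lemma coef_2N_sub (R : realType) (A B : nat -> R) i j k :
  (k <= j)%N -> (j <= i)%N ->
  coef_2N A B i k - coef_2N A B j k
  = (\prod_(k.+1 <= l < j.+1) A l) * coef_2N A B i j.
Proof.
move=> kj ji; rewrite /coef_2N (big_cat_nat kj ji) /= addrAC subrr add0r big_distrr.
rewrite /= [LHS]big_nat [RHS]big_nat; apply: eq_bigr => m /andP[jm mi].
by rewrite (@big_cat_nat _ _ _ j.+1 k.+1 m.+1) //= mulrCA.
Qed.

Lemma coef_2N_recl (R : realType) (A B : nat -> R) i j : (j < i)%N ->
  coef_2N A B i j = B j + A j.+1 * coef_2N A B i j.+1.
Proof.
move=> ji; have := @coef_2N_sub R A B i j.+1 j (leqnSn j) ji.
rewrite big_nat1 => <-.
by rewrite /coef_2N big_nat1 big_geq // mulr1 addrC subrK.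
Qed.

Lemma delta_2N_sum (R : realType) (V : lmodType R) (A : nat -> R) (h : R)
    (k : nat -> V) i :
  delta_2N A h k i.+1
  = h *: \sum_(1 <= j < i.+1) (\prod_(j.+1 <= l < i.+1) A l) *: k j.
Proof.
elim: i => [|i IHi]; first by rewrite big_geq // scaler0.
rewrite [LHS]/= -/(delta_2N A h k i.+1) IHi.
rewrite [in RHS]big_nat_recr //= (@big_geq _ _ _ i.+2 i.+2) // scale1r scalerDr; congr (_ + _).
rewrite scalerA mulrC -scalerA; congr (_ *: _).
rewrite scaler_sumr !big_nat; apply: eq_bigr => j /andP[j_gt0 ji].
by rewrite scalerA [in RHS]big_nat_recr //= mulrC.
Qed.

Lemma stage_2N_sum (R : realType) (V : lmodType R) (A B : nat -> R) (h : R)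
    (y0 : V) (k : nat -> V) i : (0 < i)%N ->
  stage_2N A B h y0 k i = y0 + h *: \sum_(1 <= j < i) coef_2N A B i j *: k j.
Proof.
case: i => // i _; elim: i => [|i IHi]; first by rewrite big_geq // scaler0 addr0.
rewrite [LHS]/= -/(delta_2N A h k i.+2) -/(stage_2N A B h y0 k i.+1).
rewrite IHi delta_2N_sum -addrA; congr (_ + _).
rewrite scalerA mulrC -scalerA -scalerDr; congr (_ *: _).
(* The vanishing diagonal coefficient extends the first sum by one term, so that both sums have the
   same range. *)
transitivity (\sum_(1 <= j < i.+2) coef_2N A B i.+1 j *: k j
  + B i.+1 *: \sum_(1 <= j < i.+2) \prod_(j.+1 <= l < i.+2) A l *: k j).
  by rewrite [in RHS]big_nat_recr //= coef_2N_geq // scale0r addr0.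
rewrite scaler_sumr -big_split /= !big_nat; apply: eq_bigr => j /andP[j_gt0 ji].
by rewrite scalerA -scalerDl /coef_2N (@big_nat_recr _ _ _ i.+1 j).
Qed.

(** * Characterisation of 2N-storage tableaux by the recursion *)

Definition rk_row (R : realType) (s : nat) (a : nat -> nat -> R) (b : nat -> R)
    (i : nat) : nat -> R :=
  if i == s.+1 then b else a i.

Lemma rk_stage_row (R : realType) (V : lmodType R) (s : nat)
    (a : nat -> nat -> R) (b : nat -> R) (h : R) (y0 : V) (k : nat -> V) i :
  rk_stage s a b h y0 k i
  = y0 + h *: \sum_(1 <= j < i) rk_row s a b i j *: k j.
Proof. by rewrite /rk_stage /rk_row; case: eqP => // ->. Qed.

(** The bound on [i] keeps all indices at most [s], where [inord] is injective and the symbols are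
    independent. *)
Lemma formal_symbol_coord (R : realType) (s : nat) (f : nat -> R) i j :
  (i <= s.+1)%N -> (1 <= j < i)%N ->
  (\sum_(1 <= k < i) f k *: formal_symbol R s k) ord0 (inord j) = f j.
Proof.
move=> i_le ji; rewrite summxE (bigD1_seq j) ?mem_index_iota ?iota_uniq //=.
rewrite !mxE !eqxx mulr1 big_nat_cond big1 ?addr0 // => k /andP[/andP[k_gt0 ki] kj].
rewrite !mxE eqxx /= -val_eqE /= !inordK; try lia.
by rewrite eq_sym (negPf kj) mulr0.
Qed.

Lemma storage_2NP (R : realType) (s : nat) (a : nat -> nat -> R) (b : nat -> R) :
  storage_2N s a b <->
  exists A B : nat -> R,
    [/\ A 1%N = 0,
        forall i, (1 <= i <= s)%N -> B i != 0
      & forall i j, (1 <= j < i)%N -> (i <= s.+1)%N ->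
          rk_row s a b i j = coef_2N A B i j].
Proof.
split=> -[A [B [A1 Bn0 AB]]]; exists A, B; split=> //.
  move=> i j ji i_le; have i_gt0 : (0 < i)%N by lia.
  (* Step size [h = 1] already determines the coefficients. *)
  have := AB 1 i; rewrite i_gt0 i_le => /(_ isT).
  rewrite rk_stage_row stage_2N_sum // => /addrI; rewrite !scale1r.
  move=> /matrixP /(_ ord0 (inord j)).
  by rewrite !formal_symbol_coord.
move=> h i /andP[i_gt0 i_le]; rewrite rk_stage_row stage_2N_sum //.
congr (_ + _ *: _); rewrite !big_nat; apply: eq_bigr => j ji.
by rewrite AB.
Qed.

Lemma rk_node_split (R : realType) (a : nat -> nat -> R) i j : (j < i)%N ->
  \sum_(1 <= k < j.+1) a i k = rk_node a i - \sum_(j.+1 <= k < i) a i k.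
Proof. by move=> ji; rewrite /rk_node (@big_cat_nat _ _ _ j.+1 1 i) //= addrK. Qed.

(* The ratio of [\sum_(k <= j) a i k - c j] to [a i j] does not depend on the
   row [i], and the weights form the row [i = s + 1]. *)
Lemma storage_2N_recursion (R : realType) (s : nat) (a : nat -> nat -> R)
    (b : nat -> R) i j :
  storage_2N s a b -> (1 <= j < i)%N -> (i <= s)%N ->
  a i j * (\sum_(1 <= k < j.+1) b k - rk_node a j)
  = b j * (rk_node a i - rk_node a j - \sum_(j.+1 <= k < i) a i k).
Proof.
move=> /storage_2NP[A [B [_ _ AB]]] /andP[j_gt0 ji] i_le.
rewrite [_ - rk_node a j - _]addrAC -rk_node_split //.
have nodeE : rk_node a j = \sum_(1 <= k < j.+1) coef_2N A B j k.
  rewrite big_nat_recr //= coef_2N_geq // addr0 /rk_node !big_nat.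
  apply: eq_bigr => k kj; rewrite -AB //; last by lia.
  by rewrite /rk_row ifN //; lia.
have rowE i' : (j < i')%N -> (i' <= s.+1)%N ->
    \sum_(1 <= k < j.+1) rk_row s a b i' k - rk_node a j
    = (\sum_(1 <= k < j.+1) \prod_(k.+1 <= l < j.+1) A l) * rk_row s a b i' j.
  move=> ji' i'_le; rewrite nodeE -sumrB big_distrl /= !big_nat.
  apply: eq_bigr => k /andP[k_gt0 kj].
  by rewrite !AB -?coef_2N_sub //; lia.
(* Rows [i] and [s.+1] share the same factor, so substituting both avoids any division. *)
have := rowE i ji (leqW i_le); have := rowE s.+1 (leq_trans ji (leqW i_le)) (leqnn _).
rewrite /rk_row eqxx ifN; last by lia.
by move=> -> ->; rewrite mulrCA [RHS]mulrCA (mulrC (b j)).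
Qed.

Lemma storage_2N_of_recursion (R : realType) (s : nat) (a : nat -> nat -> R)
    (b : nat -> R) :
  (forall j, (1 <= j < s)%N -> a j.+1 j != 0) ->
  (forall j, (1 < j < s)%N -> b j != 0) -> b s != 0 ->
  (forall j, (1 < j < s)%N -> \sum_(1 <= k < j.+1) b k - rk_node a j != 0) ->
  (forall i j, (1 < j < i)%N -> (i <= s)%N ->
    a i j * (\sum_(1 <= k < j.+1) b k - rk_node a j)
    = b j * (rk_node a i - rk_node a j - \sum_(j.+1 <= k < i) a i k)) ->
  storage_2N s a b.
Proof.
move=> subdiag_neq0 b_neq0 bs_neq0 T_neq0 recd; apply/storage_2NP.
have rec i j : (1 < j < i)%N -> (i <= s)%N ->
    a i j * (\sum_(1 <= k < j.+1) b k - rk_node a j)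
    = b j * (\sum_(1 <= k < j.+1) a i k - rk_node a j).
  move=> ji i_le; rewrite recd // rk_node_split; last by lia.
  by rewrite [_ - rk_node a j - _]addrAC.
(* These values are forced: the subdiagonal entries and [b s] give [B], and the weight row
   [b l.-1 = B l.-1 + A l * b l] gives [A]. *)
pose A l := if l == 1%N then 0 else (b l.-1 - a l l.-1) / b l.
pose B j := if j == s then b s else a j.+1 j.
exists A, B; split=> // [i i_le|].
  rewrite /B; have [//|i_neq] := eqVneq i s.
  by apply: subdiag_neq0; lia.
suff rowE d i j : (i - j)%N = d -> (1 <= j < i)%N -> (i <= s.+1)%N ->
    rk_row s a b i j = coef_2N A B i j by move=> i j; exact: rowE.
(* Induction on the distance to the diagonal, because [coef_2N_recl] computes column [j] from column
   [j.+1]. *)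
elim: d i j => [|d IHd] i j ijd ji i_le; first by lia.
rewrite coef_2N_recl; last by lia.
have [<-|i_neq] := eqVneq j.+1 i.
  rewrite coef_2N_geq // mulr0 addr0 /rk_row /B eqSS.
  by case: eqP => // ->.
rewrite -IHd; try lia.
have js : (j < s)%N by lia.
have bj_neq0 : b j.+1 != 0.
  by have [->//|?] := eqVneq j.+1 s; apply: b_neq0; lia.
rewrite /A /B /= !ifN; try lia.
rewrite /rk_row; case: eqP => [_|/eqP i_neqs]; first by field.
apply: (mulfI bj_neq0).
have -> : b j.+1 * (a j.+1 j + (b j - a j.+1 j) / b j.+1 * a i j.+1)
  = b j.+1 * a j.+1 j + (b j - a j.+1 j) * a i j.+1 by field.
have nodeS : \sum_(1 <= k < j.+1) a j.+1 k = rk_node a j.+1 by [].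
have := rec i j.+1 ltac:(lia) ltac:(lia); rewrite !(@big_nat_recr _ _ _ j.+1 1) //=.
(* The recursion is not assumed for column 1. There the partial sums are single entries and node 2
   is [a 2 1], so the recursion in column 2 is the claim. *)
have [j1|j_neq1] := eqVneq j 1%N.
  by move: nodeS; rewrite j1 !big_nat1 => <- recS; lra.
have := rec j.+1 j ltac:(lia) ltac:(lia); have := rec i j ltac:(lia) ltac:(lia).
have := T_neq0 j ltac:(lia); rewrite nodeS.
move: (\sum_(1 <= k < j.+1) a i k) (\sum_(1 <= k < j.+1) b k) => S T.
(* After multiplication by [T - rk_node a j], both column [j] recursions apply and [b j] factors
   out; what remains is the column [j.+1] recursion for row [i]. *)
move=> Tj_neq0 recij recj recS; apply: (mulIf Tj_neq0).
have -> : b j.+1 * a i j * (T - rk_node a j)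
  = b j.+1 * (a i j * (T - rk_node a j)) by ring.
have -> : (b j.+1 * a j.+1 j + (b j - a j.+1 j) * a i j.+1) * (T - rk_node a j)
  = (b j.+1 - a i j.+1) * (a j.+1 j * (T - rk_node a j))
    + b j * a i j.+1 * (T - rk_node a j) by ring.
rewrite recij recj [LHS]mulrCA (mulrCA _ (b j)) -(mulrA (b j) (a i j.+1)) -mulrDr.
congr (_ * _); lra.
Qed.

(** * Order conditions of a five-stage method *)

Ltac expand_sums :=
  repeat first [rewrite big_geq; [|by []] | rewrite big_ltn; [|by []]].

Lemma coefCE (R : realType) (c2 c3 c4 c5 b5 : R) k :
  coefC c2 c3 c4 c5 b5 k
  = (chi c2 c3 c4 c5 b5 1)`_k + (chi c2 c3 c4 c5 b5 2)`_k
    + (chi c2 c3 c4 c5 b5 3)`_k + (chi c2 c3 c4 c5 b5 4)`_k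
    + (chi c2 c3 c4 c5 b5 5)`_k + (chi c2 c3 c4 c5 b5 6)`_k.
Proof. by rewrite /coefC; expand_sums; rewrite addr0 !addrA. Qed.

(* The cubic coefficient has a factor [rho2 * (rho1 + rho2)], and the rest
   vanishes by the homogeneous parts of the first two moment equations. *)
Lemma coefC3_eq0 (R : realType) (c2 c3 c4 c5 b5 : R) :
  c3 != 0 -> c4 != 0 -> c3 != c4 -> coefC c2 c3 c4 c5 b5 3 = 0.
Proof.
move=> c3_neq0 c4_neq0 c34; have c43_neq0 : c4 - c3 != 0 by rewrite subr_eq0 eq_sym.
rewrite coefCE /= /zeta7 /rho8 /rho4 /rho5 /rho9 /rho6 /rho3.
set k := 1 - b5 - c4; set r := rho1 _ _ _; set q := rho2 _ _ _.
have m1 : c2 + c3 * r + c4 * q = 0.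
  by rewrite /r /q /rho1 /rho2; field; rewrite ?c3_neq0 ?c4_neq0 ?c43_neq0.
have m2 : c2 * (c4 - c2) + c3 * (c4 - c3) * r = 0.
  by rewrite /r /rho1; field; rewrite ?c3_neq0 ?c4_neq0 ?c43_neq0.
transitivity (b5 * ((c5 - c4) * q / k) * (r + q) * (c2 + c3 * r + c4 * q)
  - q * (r + q) * (c2 * (c4 - c2) + c3 * (c4 - c3) * r)); last first.
  by rewrite m1 m2; ring.
by ring.
Qed.

(** The last two equations form a linear system in [b3], [b4] with determinant
    [c3 * c4 * (c4 - c3)], nonzero here; the first then gives [b1]. *)
Lemma moment_conditionsP (R : realType) (c2 c3 c4 c5 b1 b2 b3 b4 b5 : R) :
  c3 != 0 -> c4 != 0 -> c3 != c4 ->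
  [/\ b1 + b2 + b3 + b4 + b5 = 1,
      b2 * c2 + b3 * c3 + b4 * c4 + b5 * c5 = 1 / 2
    & b2 * c2 ^+ 2 + b3 * c3 ^+ 2 + b4 * c4 ^+ 2 + b5 * c5 ^+ 2 = 1 / 3] <->
  [/\ b3 = omega1 c3 c4 c5 b5 + rho1 c2 c3 c4 * b2,
      b4 = omega2 c3 c4 c5 b5 + rho2 c2 c3 c4 * b2
    & b1 = 1 - b2 - b3 - b4 - b5].
Proof.
move=> c3_neq0 c4_neq0 c34; have c43_neq0 : c4 - c3 != 0 by rewrite subr_eq0 eq_sym.
rewrite /omega1 /rho1 /omega2 /rho2; split.
  move=> [m0 m1 m2]; split; last by rewrite -m0; ring.
    by rewrite -m1 -m2; field; rewrite ?c3_neq0 ?c4_neq0 ?c43_neq0.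
  by rewrite -m1 -m2; field; rewrite ?c3_neq0 ?c4_neq0 ?c43_neq0.
move=> [-> -> ->]; split; first by ring.
  by field; rewrite ?c3_neq0 ?c4_neq0 ?c43_neq0.
by field; rewrite ?c3_neq0 ?c4_neq0 ?c43_neq0.
Qed.

(* With [a54 = omega3 + rho3 * b2], the last two factors on the left are
   [omega9 + rho9 * b2] and [omega6 + rho6 * b2], and clearing denominators turns
   the six terms of the order condition into the polynomials in [b2] with
   coefficients [chi n]. *)
Lemma order_condition_cubic (R : realType) (c2 c3 c4 c5 b1 b2 b3 b4 b5
    a32 a42 a43 a52 a53 a54 : R) :
  1 - b5 - c4 != 0 ->
  b3 = omega1 c3 c4 c5 b5 + rho1 c2 c3 c4 * b2 ->
  b4 = omega2 c3 c4 c5 b5 + rho2 c2 c3 c4 * b2 ->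
  b1 = 1 - b2 - b3 - b4 - b5 ->
  a32 * (b1 + b2 - c2) = b2 * (c3 - c2) ->
  a42 * (b1 + b2 - c2) = b2 * (c4 - c2 - a43) ->
  a52 * (b1 + b2 - c2) = b2 * (c5 - c2 - a53 - a54) ->
  a43 * (b1 + b2 + b3 - c3) = b3 * (c4 - c3) ->
  a53 * (b1 + b2 + b3 - c3) = b3 * (c5 - c3 - a54) ->
  a54 * (b1 + b2 + b3 + b4 - c4) = b4 * (c5 - c4) ->
  (b3 * (a32 * c2) + b4 * (a42 * c2 + a43 * c3)
    + b5 * (a52 * c2 + a53 * c3 + a54 * c4) - 1 / 6)
  * ((b1 + b2 - c2) * (b1 + b2 + b3 - c3))
  = coefC c2 c3 c4 c5 b5 3 * b2 ^+ 3 + coefC c2 c3 c4 c5 b5 2 * b2 ^+ 2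
    + coefC c2 c3 c4 c5 b5 1 * b2 + coefC c2 c3 c4 c5 b5 0.
Proof.
move=> T4_neq0 b3E b4E b1E; set T2 := b1 + b2 - c2; set T3 := b1 + b2 + b3 - c3.
move=> e32 e42 e52 e43 e53 e54.
(* By the sum of the weights, the denominator of [a54] is the constant [1 - b5 - c4], so [a54] is
   affine in [b2]. *)
have a54E : a54 = omega3 c3 c4 c5 b5 + rho3 c2 c3 c4 c5 b5 * b2.
  apply: (mulIf T4_neq0); transitivity (b4 * (c5 - c4)).
    by rewrite -e54 b1E; ring.
  by rewrite b4E /omega3 /rho3; field.
have T3E : T3 = omega6 c3 c4 c5 b5 + rho6 c2 c3 c4 * b2.
  by rewrite /T3 b1E b4E /omega6 /rho6; ring.
have T2E : T2 = omega9 c2 c3 c4 c5 b5 + rho9 c2 c3 c4 * b2.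
  by rewrite /T2 b1E b4E b3E /omega9 /rho9; ring.
have -> : (b3 * (a32 * c2) + b4 * (a42 * c2 + a43 * c3)
    + b5 * (a52 * c2 + a53 * c3 + a54 * c4) - 1 / 6) * (T2 * T3)
  = c2 * b3 * T3 * (a32 * T2) + c2 * b4 * T3 * (a42 * T2)
    + c3 * b4 * T2 * (a43 * T3) + b5 * c2 * T3 * (a52 * T2)
    + b5 * c3 * T2 * (a53 * T3) + (b5 * c4 * a54 - 1 / 6) * (T2 * T3) by ring.
rewrite e32 e42 e43 e52 e53.
(* The recursions for [a42] and [a52] bring back [a43] and [a53]; regrouping pairs these with [T3]
   again. *)
have -> : c2 * b3 * T3 * (b2 * (c3 - c2)) + c2 * b4 * T3 * (b2 * (c4 - c2 - a43))
    + c3 * b4 * T2 * (b3 * (c4 - c3)) + b5 * c2 * T3 * (b2 * (c5 - c2 - a53 - a54))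
    + b5 * c3 * T2 * (b3 * (c5 - c3 - a54)) + (b5 * c4 * a54 - 1 / 6) * (T2 * T3)
  = c2 * b3 * T3 * (b2 * (c3 - c2)) + c2 * b4 * b2 * ((c4 - c2) * T3 - a43 * T3)
    + c3 * b4 * T2 * (b3 * (c4 - c3))
    + b5 * c2 * b2 * ((c5 - c2 - a54) * T3 - a53 * T3)
    + b5 * c3 * T2 * (b3 * (c5 - c3 - a54)) + (b5 * c4 * a54 - 1 / 6) * (T2 * T3).
  by ring.
rewrite e43 e53 !coefCE /= /zeta7 /rho7 /omega7 /omega8 /rho8.
rewrite /omega4 /rho4 /omega5 /rho5 T2E T3E a54E b3E b4E.
by ring.
Qed.

Lemma third_order5P (R : realType) (a : nat -> nat -> R) (b c : nat -> R) :
  explicit_tableau 5 a -> (forall i, (1 <= i <= 5)%N -> rk_node a i = c i) ->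
  c 1%N = 0 ->
  third_order 5 a b <->
  [/\ [/\ b 1%N + b 2%N + b 3%N + b 4%N + b 5%N = 1,
          b 2%N * c 2%N + b 3%N * c 3%N + b 4%N * c 4%N + b 5%N * c 5%N = 1 / 2
        & b 2%N * c 2%N ^+ 2 + b 3%N * c 3%N ^+ 2 + b 4%N * c 4%N ^+ 2 + b 5%N * c 5%N ^+ 2
          = 1 / 3]
    & b 3%N * (a 3%N 2%N * c 2%N) + b 4%N * (a 4%N 2%N * c 2%N + a 4%N 3%N * c 3%N)
      + b 5%N * (a 5%N 2%N * c 2%N + a 5%N 3%N * c 3%N + a 5%N 4%N * c 4%N) = 1 / 6].
Proof.
move=> expl node c1; rewrite /third_order.
have -> : \sum_(1 <= i < 6) b i = b 1%N + b 2%N + b 3%N + b 4%N + b 5%N.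
  by expand_sums; ring.
have -> : \sum_(1 <= i < 6) b i * rk_node a i
    = b 2%N * c 2%N + b 3%N * c 3%N + b 4%N * c 4%N + b 5%N * c 5%N.
  by expand_sums; rewrite !node // c1; ring.
have -> : \sum_(1 <= i < 6) b i * rk_node a i ^+ 2
    = b 2%N * c 2%N ^+ 2 + b 3%N * c 3%N ^+ 2 + b 4%N * c 4%N ^+ 2 + b 5%N * c 5%N ^+ 2.
  by expand_sums; rewrite !node // c1; ring.
have -> : \sum_(1 <= i < 6) \sum_(1 <= j < 6) b i * a i j * rk_node a j
    = b 3%N * (a 3%N 2%N * c 2%N) + b 4%N * (a 4%N 2%N * c 2%N + a 4%N 3%N * c 3%N)
      + b 5%N * (a 5%N 2%N * c 2%N + a 5%N 3%N * c 3%N + a 5%N 4%N * c 4%N).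
  expand_sums; rewrite !node // c1.
  rewrite (expl 1%N 2%N) // (expl 1%N 3%N) // (expl 1%N 4%N) // (expl 1%N 5%N) //.
  rewrite (expl 2%N 2%N) // (expl 2%N 3%N) // (expl 2%N 4%N) // (expl 2%N 5%N) //.
  rewrite (expl 3%N 3%N) // (expl 3%N 4%N) // (expl 3%N 5%N) //.
  rewrite (expl 4%N 4%N) // (expl 4%N 5%N) // (expl 5%N 5%N) //.
  by ring.
by split=> [[? ? ? ?]|[[? ? ?] ?]].
Qed.

(** * The five-stage tableau built from the nodes and weights *)

(** Each row solves the recursion from right to left, and the first column is then chosen to make
    the row sum equal to the node. *)
Definition tableau5 (R : realType) (c b : nat -> R) : nat -> nat -> R :=
  let T j := \sum_(1 <= k < j.+1) b k - c j in
  let a32 := b 2%N / T 2%N * (c 3%N - c 2%N) in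
  let a43 := b 3%N / T 3%N * (c 4%N - c 3%N) in
  let a42 := b 2%N / T 2%N * (c 4%N - c 2%N - a43) in
  let a54 := b 4%N / T 4%N * (c 5%N - c 4%N) in
  let a53 := b 3%N / T 3%N * (c 5%N - c 3%N - a54) in
  let a52 := b 2%N / T 2%N * (c 5%N - c 2%N - a53 - a54) in
  fun i j => match i, j return R with
  | 2%N, 1%N => c 2%N
  | 3%N, 1%N => c 3%N - a32
  | 3%N, 2%N => a32
  | 4%N, 1%N => c 4%N - a42 - a43
  | 4%N, 2%N => a42
  | 4%N, 3%N => a43
  | 5%N, 1%N => c 5%N - a52 - a53 - a54
  | 5%N, 2%N => a52
  | 5%N, 3%N => a53
  | 5%N, 4%N => a54
  | _, _ => 0
  end.

Lemma tableau5_explicit (R : realType) (c b : nat -> R) :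
  explicit_tableau 5 (tableau5 c b).
Proof. by move=> [|[|[|[|[|[|i]]]]]] [|[|[|[|[|[|j]]]]]]. Qed.

Lemma tableau5_node (R : realType) (c b : nat -> R) i :
  c 1%N = 0 -> (1 <= i <= 5)%N -> rk_node (tableau5 c b) i = c i.
Proof.
move=> c1; rewrite /rk_node; case: i => [|[|[|[|[|[|i]]]]]] // _;
  expand_sums; rewrite ?c1 //=; ring.
Qed.

Lemma tableau5_recursion (R : realType) (c b : nat -> R) i j :
  (forall k, (1 < k < 5)%N -> \sum_(1 <= l < k.+1) b l - c k != 0) ->
  (1 < j < i)%N -> (i <= 5)%N ->
  tableau5 c b i j * (\sum_(1 <= k < j.+1) b k - c j)
  = b j * (c i - c j - \sum_(j.+1 <= k < i) tableau5 c b i k).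
Proof.
move=> T_neq0; case: i => [|[|[|[|[|[|i]]]]]]; case: j => [|[|[|[|[|j]]]]] // _ _;
  rewrite {1}/tableau5 /= mulrAC divfK ?T_neq0 //;
  expand_sums; rewrite /tableau5 /=; ring.
Qed.

(** Distinct consecutive nodes make the subdiagonal entries, hence [B 1], ..., [B 4], nonzero: on
    the subdiagonal the right side of the recursion is [b j * (c j.+1 - c j)]. *)
Lemma tableau5_storage (R : realType) (c b : nat -> R) :
  c 1%N = 0 -> (forall j, (1 <= j < 5)%N -> c j != c j.+1) ->
  (forall j, (1 < j <= 5)%N -> b j != 0) ->
  (forall j, (1 < j < 5)%N -> \sum_(1 <= k < j.+1) b k - c j != 0) ->
  storage_2N 5 (tableau5 c b) b.
Proof.
move=> c1 c_neq b_neq0 T_neq0.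
have node i := @tableau5_node R c b i c1.
have rec i j := @tableau5_recursion R c b i j T_neq0.
apply: storage_2N_of_recursion => [j j_lt|j j_lt||j j_lt|i j ji i_le].
- have [->|j_neq1] := eqVneq j 1%N.
    by rewrite /tableau5 -c1 eq_sym c_neq.
  have := rec j.+1 j ltac:(lia) ltac:(lia).
  rewrite (@big_geq _ _ _ j.+1 j.+1) // subr0 => e.
  have : b j * (c j.+1 - c j) != 0.
    by rewrite mulf_neq0 ?b_neq0 ?subr_eq0 ?[c j.+1 == _]eq_sym ?c_neq //; lia.
  by rewrite -e mulf_eq0 negb_or => /andP[].
- by apply: b_neq0; lia.
- exact: b_neq0.
- by rewrite node; [exact: T_neq0|lia].
- rewrite (node i ltac:(lia)) (node j ltac:(lia)).
  by rewrite rec.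
Qed.

(** * Equivalence with the quadratic equation for [b 2] *)

Lemma third_order_2N_recursion (R : realType) (s : nat) (c b : nat -> R)
    (a : nat -> nat -> R) i j :
  third_order_2N_method s c b a -> (1 <= j < i)%N -> (i <= s)%N ->
  a i j * (\sum_(1 <= k < j.+1) b k - c j)
  = b j * (c i - c j - \sum_(j.+1 <= k < i) a i k).
Proof.
move=> [_ node st _] ji i_le.
rewrite -(node i ltac:(lia)) -(node j ltac:(lia)).
exact: storage_2N_recursion st ji i_le.
Qed.

Theorem mainTheorem8 (R : realType) (c b : nat -> R)
    (c1_eq0 : c 1%N = 0)
    (c2_neq0 : c 2%N != 0) (c3_neq0 : c 3%N != 0) (c4_neq0 : c 4%N != 0)
    (b5_neq0 : b 5%N != 0)
    (c2_neq_c3 : c 2%N != c 3%N) (c3_neq_c4 : c 3%N != c 4%N)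
    (c4_neq_c5 : c 4%N != c 5%N)
    (b5c4_neq0 : 1 - b 5%N - c 4%N != 0)
    (b2_neq0 : b 2%N != 0) (b3_neq0 : b 3%N != 0) (b4_neq0 : b 4%N != 0)
    (b12c2_neq0 : b 1%N + b 2%N - c 2%N != 0)
    (b123c3_neq0 : b 1%N + b 2%N + b 3%N - c 3%N != 0)
    (b1234c4_neq0 : b 1%N + b 2%N + b 3%N + b 4%N - c 4%N != 0) :
  let C := coefC (c 2%N) (c 3%N) (c 4%N) (c 5%N) (b 5%N) in
  let omega1 := omega1 (c 3%N) (c 4%N) (c 5%N) (b 5%N) in
  let rho1 := rho1 (c 2%N) (c 3%N) (c 4%N) in
  let omega2 := omega2 (c 3%N) (c 4%N) (c 5%N) (b 5%N) in
  let rho2 := rho2 (c 2%N) (c 3%N) (c 4%N) in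
  [/\ C 3%N = 0,
      (exists a : nat -> nat -> R, third_order_2N_method 5 c b a) <->
      [/\ C 2%N * b 2%N ^+ 2 + C 1%N * b 2%N + C 0%N = 0,
          b 3%N = omega1 + rho1 * b 2%N,
          b 4%N = omega2 + rho2 * b 2%N
        & b 1%N = 1 - b 2%N - b 3%N - b 4%N - b 5%N]
    & forall a : nat -> nat -> R, third_order_2N_method 5 c b a ->
      (forall i j, (2 <= j)%N -> (j < i)%N -> (i <= 5)%N ->
         a i j = b j / (\sum_(1 <= k < j.+1) b k - c j)
                 * (c i - c j - \sum_(j.+1 <= k < i) a i k)) /\
      (forall i, (2 <= i <= 5)%N ->
         a i 1%N = c i - \sum_(2 <= k < i) a i k)].
Proof.
move=> C om1 r1 om2 r2.
have T_neq0 j : (1 < j < 5)%N -> \sum_(1 <= k < j.+1) b k - c j != 0.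
  by case: j => [|[|[|[|[|j]]]]] // _; expand_sums; rewrite addr0 ?addrA.
have C3_eq0 := @coefC3_eq0 R (c 2%N) (c 3%N) (c 4%N) (c 5%N) (b 5%N)
  c3_neq0 c4_neq0 c3_neq_c4.
have momentsP := @moment_conditionsP R (c 2%N) (c 3%N) (c 4%N) (c 5%N)
  (b 1%N) (b 2%N) (b 3%N) (b 4%N) (b 5%N) c3_neq0 c4_neq0 c3_neq_c4.
(* Stated for any [a] obeying the recursion, so that it serves both a given method and
   [tableau5]. *)
have cubicE a : (forall i j, (1 < j < i)%N -> (i <= 5)%N ->
      a i j * (\sum_(1 <= k < j.+1) b k - c j)
      = b j * (c i - c j - \sum_(j.+1 <= k < i) a i k)) ->
    [/\ b 3%N = om1 + r1 * b 2%N,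
        b 4%N = om2 + r2 * b 2%N
      & b 1%N = 1 - b 2%N - b 3%N - b 4%N - b 5%N] ->
    b 3%N * (a 3%N 2%N * c 2%N) + b 4%N * (a 4%N 2%N * c 2%N + a 4%N 3%N * c 3%N)
      + b 5%N * (a 5%N 2%N * c 2%N + a 5%N 3%N * c 3%N + a 5%N 4%N * c 4%N) = 1 / 6 :> R <->
    C 2%N * b 2%N ^+ 2 + C 1%N * b 2%N + C 0%N = 0 :> R.
  move=> reca [b3E b4E b1E].
  have := @order_condition_cubic R (c 2%N) (c 3%N) (c 4%N) (c 5%N)
    (b 1%N) (b 2%N) (b 3%N) (b 4%N) (b 5%N)
    (a 3%N 2%N) (a 4%N 2%N) (a 4%N 3%N) (a 5%N 2%N) (a 5%N 3%N) (a 5%N 4%N)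
    b5c4_neq0 b3E b4E b1E.
  move: (reca 3%N 2%N isT isT) (reca 4%N 2%N isT isT) (reca 5%N 2%N isT isT).
  move: (reca 4%N 3%N isT isT) (reca 5%N 3%N isT isT) (reca 5%N 4%N isT isT).
  expand_sums; rewrite !(addr0, subr0, opprD, addrA).
  move=> e43 e53 e54 e32 e42 e52 /(_ e32 e42 e52 e43 e53 e54).
  (* The cubic term drops out, and the nonzero denominators for columns 2 and 3 can be cancelled. *)
  rewrite C3_eq0 mul0r add0r /C => <-; split=> [->|/eqP].
    by rewrite subrr mul0r.
  rewrite !mulf_eq0 subr_eq0 (negPf b12c2_neq0) (negPf b123c3_neq0) !orbF.
  by move/eqP.
split=> //; last first.
  move=> a meth; split=> [i j j_ge2 ji i_le|i /andP[i_gt1 i_le]].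
    have j_lt : (1 < j < 5)%N by rewrite j_ge2 (leq_trans ji).
    rewrite mulrAC -(third_order_2N_recursion meth) ?mulfK ?T_neq0 //.
    by rewrite ji (ltnW j_ge2).
  have [_ node _ _] := meth; rewrite -(node i) ?i_le ?(ltnW i_gt1) //.
  by rewrite /rk_node big_ltn // addrK.
split.
  move=> [a meth]; have [expl node _] := meth.
  move=> /(third_order5P _ expl node c1_eq0)[/momentsP b_eqs order4].
  have [b3E b4E b1E] := b_eqs; split=> //.
  apply/(cubicE a) => // i j /andP[j_gt1 ji] i_le.
  by apply: (third_order_2N_recursion meth) => //; rewrite ji (ltnW j_gt1).
move=> [quad b3E b4E b1E]; exists (tableau5 c b).
have node i := @tableau5_node R c b i c1_eq0.
have rec i j := @tableau5_recursion R c b i j T_neq0.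
split=> //; first exact: tableau5_explicit.
  apply: tableau5_storage => //.
    (* For [j = 1], distinctness of the nodes is [c 2 != 0]. *)
    by case=> [|[|[|[|[|j]]]]] //= _; rewrite c1_eq0 eq_sym.
  by case=> [|[|[|[|[|[|j]]]]]].
apply/(third_order5P _ (@tableau5_explicit R c b) node c1_eq0); split.
  exact/momentsP.
exact/(cubicE _ rec).
Qed.
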